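(* Let $R$ be a commutative ring with a derivation $D_R$. Let $A$ be a differential Azumaya $R$-algebra, and let $P$ be an $A$-module which is finitely generated and projective as an $R$-module. Then there is a differential structure on $P$ making $P$ a differential $A$-module.
   Context: A differential Azumaya $R$-algebra is an Azumaya $R$-algebra $A$ with a derivation $D_A$ extending $D_R$. A (left) $A$-module $P$ is a differential $A$-module if it is equipped with an additive endomorphism $D_P$ (a differential structure) satisfying $D_P(ap)=D_A(a)p+aD_P(p)$ for all $a\in A$, $p\in P$. *)

(* Defs.v *)
From HB Require Import structures.
From mathcomp Require Import all_boot all_order all_algebra.

Set Implicit Arguments.
Unset Strict Implicit.
Unset Printing Implicit Defensive.

Import GRing.Theory.
Local Open Scope ring_scope.

(* An R-algebra is a ring A with a structure morphism iota : R -> A whose image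
   is central.  [algType] is not used because it excludes the zero ring. *)
Definition algebra_morphism (R : comPzRingType) (A : pzRingType)
  (iota : {rmorphism R -> A}) : Prop :=
  forall (r : R) (a : A), iota r * a = a * iota r.

Definition restrict_scalars (R A : pzRingType) (iota : {rmorphism R -> A})
  (P : lmodType A) : Type := P.

Section RestrictScalars.
Variables (R A : pzRingType) (iota : {rmorphism R -> A}) (P : lmodType A).

HB.instance Definition _ := GRing.Zmodule.on (restrict_scalars iota P).

Let scale (r : R) (p : restrict_scalars iota P) : restrict_scalars iota P :=
  iota r *: (p : P).

Let scaleA r s p : scale r (scale s p) = scale (r * s) p.
Proof. by rewrite /scale scalerA -rmorphM. Qed.

Let scale1 : left_id 1 scale.
Proof. by move=> p; rewrite /scale rmorph1 scale1r. Qed.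

Let scaleDr : right_distributive scale +%R.
Proof. by move=> r p q; rewrite /scale scalerDr. Qed.

Let scaleDl p : {morph scale^~ p : r s / r + s}.
Proof. by move=> r s; rewrite /scale rmorphD scalerDl. Qed.

HB.instance Definition _ := GRing.Zmodule_isLmodule.Build R
  (restrict_scalars iota P) scaleA scale1 scaleDr scaleDl.

End RestrictScalars.

Notation algebra_module iota := (restrict_scalars iota (GRing.regular _)).

Definition finitely_generated (R : pzRingType) (M : lmodType R) : Prop :=
  exists (n : nat) (e : 'I_n -> M),
    forall x : M, exists c : 'I_n -> R, x = \sum_i c i *: e i.

Definition projective (R : pzRingType) (M : lmodType R) : Prop :=
  forall (X Y : lmodType R) (g : {linear X -> Y}) (f : {linear M -> Y}),
    (forall y, exists x, g x = y) ->
    exists h : {linear M -> X}, forall m, g (h m) = f m.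

Definition faithful_module (R : pzRingType) (M : lmodType R) : Prop :=
  forall r : R, (forall x : M, r *: x = 0) -> r = 0.

(* M (x)_R N is presented as formal sums of pure tensors modulo a congruence:
   the list [:: (m1, n1); ...; (mk, nk)] stands for the sum of the mi (x) ni,
   and [tensor_eq s t] says that s and t are equal in M (x)_R N.  No scalars
   are needed on the formal sums since r (m (x) n) = (r m) (x) n, and no formal
   opposites since (- m) (x) n is the opposite of m (x) n. *)
Inductive tensor_eq (R : comPzRingType) (M N : lmodType R) :
    seq (M * N) -> seq (M * N) -> Prop :=
| tensor_refl s : tensor_eq s s
| tensor_sym s t : tensor_eq s t -> tensor_eq t s
| tensor_trans s t u : tensor_eq s t -> tensor_eq t u -> tensor_eq s u
| tensor_cat s s' t t' :
    tensor_eq s s' -> tensor_eq t t' -> tensor_eq (s ++ t) (s' ++ t')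
| tensor_catC s t : tensor_eq (s ++ t) (t ++ s)
| tensor_0 n : tensor_eq [:: (0, n)] [::]
| tensor_Dl m m' n : tensor_eq [:: (m + m', n)] [:: (m, n); (m', n)]
| tensor_Dr m n n' : tensor_eq [:: (m, n + n')] [:: (m, n); (m, n')]
| tensor_Z (r : R) m n : tensor_eq [:: (r *: m, n)] [:: (m, r *: n)].

(* The canonical algebra morphism A (x)_R A^op -> End_R(A), which sends
   a (x) b to x |-> a x b, computed on formal sums. *)
Definition sandwich (A : pzRingType) (t : seq (A * A)) (x : A) : A :=
  \sum_(u <- t) u.1 * x * u.2.

Lemma sandwich_is_linear (R : comPzRingType) (A : pzRingType)
  (iota : {rmorphism R -> A}) (hiota : algebra_morphism iota)
  (t : seq (A * A)) :
  linear (sandwich t : algebra_module iota -> algebra_module iota).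
Proof.
move=> r x y; rewrite /sandwich [LHS](_ : _ =
  \sum_(u <- t) (iota r * (u.1 * (x : A) * u.2) + u.1 * (y : A) * u.2)).
  by rewrite big_split -mulr_sumr.
by apply: eq_bigr => u _; rewrite mulrDr mulrDl !mulrA hiota.
Qed.

Lemma sandwich_tensor_eq (R : comPzRingType) (A : pzRingType)
  (iota : {rmorphism R -> A}) (hiota : algebra_morphism iota)
  (s t : seq (algebra_module iota * algebra_module iota)) :
  tensor_eq s t -> sandwich (s : seq (A * A)) =1 sandwich (t : seq (A * A)).
Proof.
have sw1 (u : A * A) x : sandwich [:: u] x = u.1 * x * u.2.
  by rewrite /sandwich big_seq1.
have sw_cat (u v : seq (A * A)) x :
    sandwich (u ++ v) x = sandwich u x + sandwich v x.
  by rewrite /sandwich big_cat.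
move=> st x; elim: st => {s t}.
- by [].
- by move=> s t _ ->.
- by move=> s t u _ -> _ ->.
- by move=> s s' t t' _ + _; rewrite !sw_cat => -> ->.
- by move=> s t; rewrite !sw_cat addrC.
- by move=> n; rewrite sw1 /sandwich big_nil /= !mul0r.
- move=> m m' n; rewrite (sw_cat [:: (m, n)] [:: (m', n)]) !sw1 /=.
  by rewrite -mulrDl -mulrDl.
- move=> m n n'; rewrite (sw_cat [:: (m, n)] [:: (m, n')]) !sw1 /=.
  by rewrite -mulrDr.
- move=> r m n; rewrite !sw1 /=.
  change (iota r * (m : A) * x * (n : A) = (m : A) * x * (iota r * (n : A))).
  by rewrite [RHS]mulrA -(hiota r (_ * x)) !mulrA.
Qed.

(* A is a faithful finitely generated projective R-module and
   A (x)_R A^op -> End_R(A) is an isomorphism; the last two fields are its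
   surjectivity and its injectivity. *)
Record azumaya (R : comPzRingType) (A : pzRingType)
    (iota : {rmorphism R -> A}) : Prop := Azumaya {
  azumaya_algebra : algebra_morphism iota;
  azumaya_fg : finitely_generated (algebra_module iota);
  azumaya_projective : projective (algebra_module iota);
  azumaya_faithful : faithful_module (algebra_module iota);
  azumaya_surj : forall f : {linear algebra_module iota -> algebra_module iota},
    exists t : seq (A * A), forall x : A, sandwich t x = f x;
  azumaya_inj : forall s t : seq (A * A),
    (forall x : A, sandwich s x = sandwich t x) ->
    @tensor_eq R (algebra_module iota) (algebra_module iota) s t
}.

Definition derivation (S : pzRingType) (D : {additive S -> S}) : Prop :=
  forall x y : S, D (x * y) = D x * y + x * D y.

Definition extends_derivation (R A : pzRingType) (iota : {rmorphism R -> A})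
  (DR : {additive R -> R}) (DA : {additive A -> A}) : Prop :=
  forall r : R, DA (iota r) = iota (DR r).

Definition differential_structure (A : pzRingType) (DA : {additive A -> A})
  (P : lmodType A) (DP : {additive P -> P}) : Prop :=
  forall (a : A) (p : P), DP (a *: p) = DA a *: p + a *: DP p.

(* Main.v *)
(* An R-linear form pi on A with pi 1 = 1 exists by the determinant trick: the
   values at 1 of the linear forms on A make up an ideal I with I A = A.  The
   endomorphism x |-> iota (pi x) of A is x |-> sum_j u_j x v_j for some u_j,
   v_j; since its values are central, injectivity of A (x) A^op -> End_R(A)
   makes sum_j u_j (x) v_j a separability idempotent.  It turns an R-dual basis
   (phi_i, e_i) of P into the A-dual basis (p |-> sum_j u_j phi_i (v_j p), e_i),
   and p |-> sum_i DA (psi_i p) e_i is a differential structure on P for any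
   A-dual basis (psi_i, e_i). *)
Require Import Defs.
From HB Require Import structures.
From mathcomp Require Import all_boot all_order all_algebra.

Set Implicit Arguments.
Unset Strict Implicit.
Unset Printing Implicit Defensive.

Import GRing.Theory.
Local Open Scope ring_scope.

Definition dual_basis (S : pzRingType) (M : lmodType S) (n : nat)
    (e : 'I_n -> M) (f : 'I_n -> {linear M -> S^o}) : Prop :=
  forall x : M, x = \sum_i (f i x : S) *: e i.

Lemma linear_bundle (S : pzRingType) (U V : lmodType S) (f : U -> V) :
  linear f -> exists g : {linear U -> V}, g =1 f.
Proof.
move=> f_lin.
pose g : {linear U -> V} := HB.pack f (GRing.isLinear.Build S U V _ f f_lin).
by exists g.
Qed.

Lemma additive_bundle (U V : zmodType) (f : U -> V) :
  {morph f : x y / x - y} -> exists g : {additive U -> V}, g =1 f.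
Proof.
move=> f_add.
pose g : {additive U -> V} := HB.pack f (GRing.isZmodMorphism.Build U V f f_add).
by exists g.
Qed.

Lemma projective_dual_basis (S : pzRingType) (M : lmodType S) :
  finitely_generated M -> projective M ->
  exists (n : nat) (e : 'I_n -> M) (f : 'I_n -> {linear M -> S^o}),
    dual_basis e f.
Proof.
move=> [n [e e_gen]] projM.
have comb_lin : linear (fun c : 'rV[S]_n => \sum_i c 0 i *: e i).
  move=> r c d; rewrite scaler_sumr -big_split; apply: eq_bigr => i _.
  by rewrite !mxE scalerDl scalerA.
have [comb combE] := linear_bundle comb_lin.
have comb_surj y : exists x, comb x = y.
  have [c ->] := e_gen y; exists (\row_i c i).
  by rewrite combE; apply: eq_bigr => i _; rewrite mxE.
have [h hK] := projM _ _ comb idfun comb_surj.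
have coord_lin i : linear (fun x => h x 0 i : S^o).
  by move=> r x y; rewrite linearP !mxE.
have [f fE] := fin_all_exists (fun i => linear_bundle (coord_lin i)).
exists n, e, f => x; rewrite -[LHS](hK x) combE.
by apply: eq_bigr => i _; rewrite fE.
Qed.

Lemma det_congr (R : comPzRingType) (I : R -> Prop) (n : nat) (M N : 'M[R]_n) :
  I 0 -> (forall x y, I x -> I y -> I (x + y)) ->
  (forall r x, I x -> I (r * x)) ->
  (forall i j, I (M i j - N i j)) -> I (\det M - \det N).
Proof.
move=> I0 ID IM MN; apply: (big_ind2 (fun x y => I (x - y))) => [|x x' y y'|s _].
- by rewrite subr0.
- by rewrite opprD addrACA; apply: ID.
rewrite -mulrBr; apply: (IM).
apply: (big_ind2 (fun x y => I (x - y))) => [|x x' y y' xx' yy'|i _].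
- by rewrite subrr.
- have -> : x * y - x' * y' = y * (x - x') + x' * (y - y').
    by rewrite !mulrBr addrA (mulrC y x) (mulrC y x') subrK.
  by apply: ID; apply: IM.
- exact: MN.
Qed.

Lemma det_annihilates (R : comPzRingType) (V : lmodType R) (n : nat)
    (N : 'M[R]_n) (e : 'I_n -> V) :
  (forall i, \sum_k N i k *: e k = 0) -> forall k, \det N *: e k = 0.
Proof.
move=> N_e k.
have adjE l : \sum_i (\adj N) k i * N i l = \det N *+ (k == l).
  by transitivity ((\adj N *m N) k l); [rewrite mxE | rewrite mul_adj_mx mxE].
have : \sum_i (\adj N) k i *: \sum_l N i l *: e l = 0.
  by rewrite big1 // => i _; rewrite N_e scaler0.
under eq_bigr => i _ do rewrite scaler_sumr.
rewrite exchange_big /=.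
under eq_bigr => l _.
  under eq_bigr => i _ do rewrite scalerA.
  rewrite -scaler_suml adjE; over.
rewrite (bigD1 k) //= big1 => [|l /negPf lk]; first by rewrite eqxx addr0.
by rewrite eq_sym lk scale0r.
Qed.

Lemma tensor_eq_bilinear (R : comPzRingType) (M N : lmodType R) (V : zmodType)
    (B : M -> N -> V) (s t : seq (M * N)) :
  (forall n, {morph B^~ n : m m' / m + m'}) ->
  (forall m, {morph B m : n n' / n + n'}) ->
  (forall r m n, B (r *: m) n = B m (r *: n)) ->
  tensor_eq s t -> \sum_(u <- s) B u.1 u.2 = \sum_(u <- t) B u.1 u.2.
Proof.
move=> BDl BDr BZ; elim=> {s t} //.
- by move=> s t u _ -> _ ->.
- by move=> s s' t t' _ ss' _ tt'; rewrite !big_cat ss' tt'.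
- by move=> s t; rewrite !big_cat /= addrC.
- move=> n; rewrite big_seq1 big_nil /=.
  by apply: (addrI (B 0 n)); rewrite -BDl !addr0.
- by move=> m m' n; rewrite !big_cons !big_nil /= !addr0 BDl.
- by move=> m n n'; rewrite !big_cons !big_nil /= !addr0 BDr.
- by move=> r m n; rewrite !big_seq1 /= BZ.
Qed.

Section Azumaya.
Variables (R : comPzRingType) (A : pzRingType) (iota : {rmorphism R -> A}).
Hypothesis hA : azumaya iota.
Local Notation AR := (algebra_module iota).

Lemma azumaya_unit_retraction :
  exists pi : {linear AR -> R^o}, pi (1 : A) = 1.
Proof.
have [n [e [f ef]]] :=
  projective_dual_basis (azumaya_fg hA) (azumaya_projective hA).
pose I (r : R) := exists pi : {linear AR -> R^o}, pi (1 : A) = r.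
have I0 : I 0 by exists (\0 : {linear AR -> R^o}).
have ID x y : I x -> I y -> I (x + y).
  by move=> [p <-] [q <-]; exists (p \+ q : {linear AR -> R^o}).
have IM r x : I x -> I (r * x).
  by move=> [p <-]; exists (r \*: p : {linear AR -> R^o}).
pose M : 'M[R]_n := \matrix_(i, k)
  \sum_j f k ((e j : A) * (e i : A)) * f j (1 : A).
have MI i k : I (M i k).
  by rewrite mxE; apply: big_ind => // j _; apply: IM; exists (f j).
have Me i : e i = \sum_k M i k *: e k.
  have -> : e i = \sum_j (f j (1 : A) : R) *: ((e j : A) * (e i : A) : AR).
    rewrite -[LHS](mul1r (e i : A)) [X in X * _](ef (1 : A)) mulr_suml.
    by apply: eq_bigr => j _; apply/esym/mulrA.
  under eq_bigr => j _ do rewrite {1}(ef ((e j : A) * (e i : A))) scaler_sumr.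
  rewrite exchange_big; apply: eq_bigr => k _.
  rewrite mxE scaler_suml; apply: eq_bigr => j _.
  by rewrite scalerA mulrC.
pose N := 1%:M - M.
have NE i k : N i k = (i == k)%:R - M i k.
  by rewrite [LHS]mxE [X in X + _]mxE [X in _ + X]mxE.
have N_e i : \sum_k N i k *: e k = 0.
  under eq_bigr => k _ do rewrite NE scalerBl.
  rewrite sumrB -Me (bigD1 i) //= big1 => [|k /negPf ki].
    by rewrite eqxx scale1r addr0 subrr.
  by rewrite eq_sym ki scale0r.
have det_e := det_annihilates N_e.
have det0 : \det N = 0.
  apply: (azumaya_faithful hA) => x; rewrite (ef x) scaler_sumr big1 // => k _.
  by rewrite scalerA mulrC -scalerA det_e scaler0.
have : I (\det (1%:M : 'M[R]_n) - \det N).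
  apply: det_congr => // i k; rewrite (_ : _ - _ = M i k) //.
  by rewrite NE mxE opprB addrC subrK.
by rewrite det0 det1 subr0.
Qed.

Lemma azumaya_separability_idempotent :
  exists t : seq (AR * AR),
    \sum_(u <- t) (u.1 : A) * (u.2 : A) = 1 /\
    forall a : A, tensor_eq [seq (a * (u.1 : A) : AR, u.2) | u <- t]
                            [seq (u.1, (u.2 : A) * a : AR) | u <- t].
Proof.
have [pi pi1] := azumaya_unit_retraction.
have pi_lin : linear (fun x : AR => iota (pi x) : AR).
  by move=> r x y; rewrite linearP rmorphD rmorphM.
have [g gE] := linear_bundle pi_lin.
have [t tE] := azumaya_surj hA g.
exists t; split=> [|a].
  rewrite -[RHS](rmorph1 iota) -pi1 -(gE (1 : A)) -tE.
  by apply: eq_bigr => u _; rewrite mulr1.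
apply: (azumaya_inj hA) => x; rewrite /sandwich !big_map /=.
under eq_bigr => u _ do rewrite -!mulrA.
under [RHS]eq_bigr => u _ do rewrite mulrA.
rewrite -mulr_sumr -mulr_suml.
under eq_bigr => u _ do rewrite mulrA.
have := tE x; rewrite /sandwich gE => ->.
by rewrite (azumaya_algebra hA).
Qed.

Lemma azumaya_dual_basis (P : lmodType A) :
  finitely_generated (restrict_scalars iota P) ->
  projective (restrict_scalars iota P) ->
  exists (n : nat) (e : 'I_n -> P) (f : 'I_n -> {linear P -> A^o}),
    dual_basis e f.
Proof.
move=> fgP projP.
have [n [e [f ef]]] := projective_dual_basis fgP projP.
have [t [t1 ta]] := azumaya_separability_idempotent.
pose psi i (p : P) : A^o :=
  \sum_(u <- t) (u.1 : A) * iota (f i ((u.2 : A) *: p)).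
have psi_lin i : linear (psi i).
  move=> a p q; rewrite /psi.
  under eq_bigr => u _ do rewrite scalerDr linearD rmorphD mulrDr.
  rewrite big_split; congr (_ + _).
  pose B (x y : AR) : A := (x : A) * iota (f i ((y : A) *: p)).
  have := tensor_eq_bilinear (B := B) _ _ _ (ta a).
  rewrite !big_map /B /= => BE.
  under eq_bigr => u _ do rewrite scalerA.
  rewrite -BE => [|y x x'|x y y'|r x y].
  - by rewrite scaler_sumr; apply: eq_bigr => u _; rewrite -mulrA.
  - by rewrite mulrDl.
  - by rewrite scalerDl linearD rmorphD mulrDr.
  - rewrite (_ : (_ *: y : A) *: p =
      r *: ((y : A) *: p : restrict_scalars iota P)); last first.
      by rewrite -[LHS]scalerA.
    rewrite linearZ rmorphM mulrA; congr (_ * _).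
    exact: (azumaya_algebra hA).
have [g gE] := fin_all_exists (fun i => linear_bundle (psi_lin i)).
exists n, e, g => p.
under eq_bigr => i _ do rewrite gE scaler_suml.
rewrite exchange_big /= -[LHS]scale1r -t1 scaler_suml.
apply: eq_bigr => u _; rewrite -scalerA {1}(ef ((u.2 : A) *: p)).
by rewrite scaler_sumr; apply: eq_bigr => i _; rewrite -scalerA.
Qed.

End Azumaya.

Lemma dual_basis_differential_structure (A : pzRingType) (DA : {additive A -> A})
    (P : lmodType A) (n : nat) (e : 'I_n -> P) (f : 'I_n -> {linear P -> A^o}) :
  derivation DA -> dual_basis e f ->
  exists DP : {additive P -> P}, differential_structure DA DP.
Proof.
move=> DA_der ef.
have D_add : {morph (fun p : P => \sum_i DA (f i p) *: e i) : p q / p - q}.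
  move=> p q; rewrite -sumrB; apply: eq_bigr => i _.
  by rewrite linearB raddfB scalerBl.
have [DP DPE] := additive_bundle D_add.
exists DP => a p; rewrite !DPE {2}(ef p) !scaler_sumr -big_split.
by apply: eq_bigr => i _; rewrite linearZ DA_der scalerDl !scalerA.
Qed.

Theorem corollary2 (R : comPzRingType) (DR : {additive R -> R})
  (hDR : derivation DR)
  (A : pzRingType) (iota : {rmorphism R -> A}) (hA : azumaya iota)
  (DA : {additive A -> A}) (hDA : derivation DA)
  (hext : extends_derivation iota DR DA)
  (P : lmodType A)
  (hPfg : finitely_generated (restrict_scalars iota P))
  (hPproj : projective (restrict_scalars iota P)) :
  exists DP : {additive P -> P}, differential_structure DA DP.
Proof.
have [n [e [f ef]]] := azumaya_dual_basis hA hPfg hPproj.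
exact: dual_basis_differential_structure hDA ef.
Qed.
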